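(* Let $\ell\ge1$ be an integer, $p>0$, $q=1-p$, $p<q$, and $\rho=p/q$. The maximum (Perron–Frobenius) eigenvalue of $R$ is $\eta=\rho^{2\ell}$, and its corresponding left eigenvector is $$\boldsymbol u=\begin{bmatrix}1&\rho^2&\cdots&\rho^{2(\ell-1)}\end{bmatrix}^{T},$$ i.e. $\boldsymbol u^{T}R=\eta\,\boldsymbol u^{T}$.
   Context: For $-\ell\le j\le\ell$ put $p_j=\binom{2\ell}{\ell+j}p^{\ell+j}q^{\ell-j}$, and $p_j=0$ for $|j|>\ell$. Define the $\ell\times\ell$ matrices $A_{-1},A_0,A_1$ by $(A_k)_{ij}=p_{k\ell+j-i}$ for $k\in\{-1,0,1\}$, $1\le i,j\le\ell$. The matrix $R$ is the unique (entrywise) non-negative $\ell\times\ell$ matrix with all eigenvalues in the open unit disk solving $R^2A_{-1}+R(A_0-I)+A_1=0$ (existence and uniqueness are standard for positive recurrent quasi-birth-and-death processes). The maximum eigenvalue is the non-negative real eigenvalue equal to the spectral radius of $R$. *)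

(* Defs.v *)
From mathcomp Require Export all_boot all_order all_algebra.
From mathcomp Require Export classical_sets reals.
From mathcomp Require Export complex.
Set Implicit Arguments.
Unset Strict Implicit.
Unset Printing Implicit Defensive.
Import Order.TTheory GRing.Theory Num.Theory.
Local Open Scope ring_scope.

(* On the nonzero branch l + j and l - j are nonnegative, so absz only casts
   them to nat. *)
Definition jump (T : realType) (l : nat) (p q : T) (j : int) : T :=
  if (- l%:Z <= j <= l%:Z) then
    'C(2 * l, absz (l%:Z + j))%:R * p ^+ absz (l%:Z + j) * q ^+ absz (l%:Z - j)
  else 0.

(* Indices run over 0, ..., l - 1 instead of 1, ..., l; the shift cancels in
   j - i. *)
Definition qbd_block (T : realType) (l : nat) (p q : T) (k : int) : 'M[T]_l :=
  \matrix_(i < l, j < l) jump l p q (k * l%:Z + j%:Z - i%:Z).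

Definition complex_eigenvalue (T : realType) (n : nat) (A : 'M[T]_n)
    (z : T[i]) : bool :=
  eigenvalue (map_mx (real_complex T) A) z.

(* The set is finite, and nonempty when n > 0, so that sup is a maximum. *)
Definition spectral_radius (T : realType) (n : nat) (A : 'M[T]_n) : T :=
  sup [set x | exists2 z : T[i],
         complex_eigenvalue A z & ComplexField.Normc.normc z = x]%classic.

Definition max_eigenvalue (T : realType) (n : nat) (A : 'M[T]_n) (x : T) : Prop :=
  [/\ 0 <= x, eigenvalue A x & x = spectral_radius A].

Definition rate_matrix (T : realType) (l : nat) (p q : T) (R : 'M[T]_l) : Prop :=
  [/\ forall i j, 0 <= R i j,
      forall z : T[i],
        complex_eigenvalue R z -> ComplexField.Normc.normc z < 1
    & R *m R *m qbd_block l p q (-1) + R *m (qbd_block l p q 0 - 1%:M)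
        + qbd_block l p q 1 = 0].

(* Main.v *)
Require Import Defs.
From mathcomp Require Import zify ring.

(** Write L(x) = A_1 + x (A_0 - I) + x^2 A_{-1}.  The equation satisfied by R
    says that xI - R divides L(x) on the left:
      L(x) = (xI - R) G(x),  G(x) = (xI + R) A_{-1} + A_0 - I.
    So wherever G(x) is invertible, a row vector killed by L(x) is a left
    eigenvector of R for x.

    The jump law has generating function (p + q x)^(2l), so the geometric row
    (1, x, ..., x^(l-1)) satisfies
      w (A_1 + x^l A_0 + x^(2l) A_{-1}) = (p + q x)^(2l) w
    ([qbd_row_genfun]).  It is killed by L(x^l) as soon as
    (p + q x)^(2l) = x^l, and x = rho^2 is a solution because
    p + q rho^2 = rho; then w = u^T and x^l = eta.  The solution x = 1 says
    that A_1 + A_0 + A_{-1} is stochastic, that is L(1) 1 = 0.  Since I - R is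
    invertible, G(1) 1 = 0 follows: the non-negative matrix
    A_{-1} + A_0 + R A_{-1} is stochastic.  For 0 <= x < 1, replacing its first
    summand by x A_{-1}, whose diagonal is positive, makes every row sum less
    than 1, so 1 is no longer an eigenvalue and G(x) is invertible
    ([right_factor_unit]).  At x = eta < 1 this gives u^T R = eta u^T.

    As R is non-negative and u is positive, eta is the spectral radius of R:
    comparing the moduli of any left eigenvector with u
    ([collatz_wielandt]) bounds every complex eigenvalue by eta. *)

Import Order.TTheory GRing.Theory Num.Theory.
Set Implicit Arguments.
Unset Strict Implicit.
Local Open Scope ring_scope.

Lemma jump_ge0 (T : realType) (l : nat) (p q : T) (j : int) :
  0 <= p -> 0 <= q -> 0 <= jump l p q j.
Proof.
move=> p0 q0; rewrite /jump; case: ifP => // _.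
by rewrite !mulr_ge0 ?exprn_ge0 ?ler0n.
Qed.

Lemma jump_sub (T : realType) (l s : nat) (p q : T) : (s <= 2 * l)%N ->
  jump l p q (l%:Z - s%:Z) = 'C(2 * l, s)%:R * p ^+ (2 * l - s) * q ^+ s.
Proof.
move=> sl; rewrite /jump ifT; last by lia.
have e1 : (l%:Z + (l%:Z - s%:Z))%R = Posz (2 * l - s) by lia.
have e2 : (l%:Z - (l%:Z - s%:Z))%R = Posz s by lia.
rewrite e1 bin_sub //; congr (_ * _ ^+ _); exact: congr1 e2.
Qed.

(** The range of summation, three blocks of length l, contains the whole
    support [j, j + 2l] of the summand: this is where j < l matters.  What is
    left is the binomial expansion. *)
Lemma jump_genfun (T : realType) (l j : nat) (p q x : T) : (j < l)%N ->
  \sum_(n < l + l + l) x ^+ n * jump l p q (l%:Z + j%:Z - n%:Z)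
  = x ^+ j * (p + q * x) ^+ (2 * l).
Proof.
move=> jl; pose F n := x ^+ n * jump l p q (l%:Z + j%:Z - n%:Z).
rewrite -(big_mkord xpredT F) (@big_cat_nat _ _ _ j) //=; last by lia.
rewrite [X in X + _]big_nat big1 => [|n]; last first.
  by rewrite /F /jump => nj; rewrite ifF ?mulr0 //; lia.
rewrite add0r (@big_cat_nat _ _ _ (j + (2 * l).+1)) //=; [|by lia|by lia].
rewrite [X in _ + X]big_nat [X in _ + X]big1 => [|n]; last first.
  by rewrite /F /jump => nj; rewrite ifF ?mulr0 //; lia.
rewrite addr0 -[X in \sum_(X <= _ < _) _]add0n big_addn addKn big_mkord.
rewrite exprDn mulr_sumr; apply: eq_bigr => s _.
rewrite /F exprD exprMn -mulr_natr.
(* Shifting the index by j turns the summand into the s-th binomial term. *)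
have -> : l%:Z + j%:Z - (s + j)%N%:Z = l%:Z - s%:Z by lia.
by rewrite jump_sub -1?ltnS //; ring.
Qed.

(** The three blocks side by side are a window of width 3l of one infinite
    Toeplitz matrix, and the weights 1, x^l, x^(2l) turn three copies of the
    geometric row into a single geometric row of length 3l. *)
Lemma qbd_row_genfun (T : realType) (l : nat) (p q x : T) :
  (\row_(i < l) x ^+ i) *m (qbd_block l p q 1 + x ^+ l *: qbd_block l p q 0
     + x ^+ (l + l) *: qbd_block l p q (-1))
  = (p + q * x) ^+ (2 * l) *: \row_(i < l) x ^+ i.
Proof.
apply/rowP => j; rewrite !mxE [RHS]mulrC -jump_genfun //.
rewrite !big_split_ord /= -!big_split /=; apply: eq_bigr => i _.
rewrite !mxE !exprD !mulrDr !mulrA.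
congr (_ * jump _ _ _ _ + _ * jump _ _ _ _ + _ * jump _ _ _ _);
  by [lia | ring].
Qed.

(** Toeplitz matrices are symmetric about the antidiagonal; this exchanges
    row sums and column sums of the blocks. *)
Lemma qbd_block_rev (T : realType) (l : nat) (p q : T) k (i j : 'I_l) :
  qbd_block l p q k (rev_ord i) (rev_ord j) = qbd_block l p q k j i.
Proof.
rewrite !mxE; congr jump => /=.
by have := ltn_ord i; have := ltn_ord j; lia.
Qed.

Lemma qbd_stochastic (T : realType) (l : nat) (p q : T) : p + q = 1 ->
  (qbd_block l p q 1 + qbd_block l p q 0 + qbd_block l p q (-1))
    *m const_mx 1 = const_mx 1 :> 'cV[T]_l.
Proof.
move=> pq1; apply/colP => i; rewrite [LHS]mxE [RHS]mxE.
have /rowP/(_ (rev_ord i)) := qbd_row_genfun l p q 1.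
rewrite mulr1 pq1 !expr1n !scale1r [RHS]mxE expr1n [LHS]mxE => sum1.
rewrite -[RHS]sum1 (reindex_inj rev_ord_inj); apply: eq_bigr => j _.
rewrite [const_mx _ _ _]mxE mulr1 [(\row_(_ < _) _) _ _]mxE expr1n mul1r.
have addE (A B C : 'M[T]_l) r c : (A + B + C) r c = A r c + B r c + C r c.
  by rewrite !mxE.
by rewrite !addE -!(qbd_block_rev p q _ (rev_ord j)) rev_ordK.
Qed.

Lemma eigenvalue_unitmx (F : fieldType) (n : nat) (A : 'M[F]_n) (a : F) :
  eigenvalue A a = (A - a%:M \notin unitmx).
Proof. by rewrite /eigenvalue /eigenspace kermx_eq0 row_free_unit. Qed.

(** Half of the Collatz-Wielandt characterization of the Perron root.  For a
    left eigenvector v, the index j is one where |v_j| / w_j is maximal: if a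
    is this maximum then |v| <= a w, so
    |z| a w_j = |z v_j| <= (|v| M)_j <= a (w M)_j, and a > 0 cancels.  Keeping
    the index, rather than a bound on |z|, serves both weights with
    w M = c w and weights with w M < w entrywise. *)
Lemma collatz_wielandt (T : realType) (n : nat) (M : 'M[T]_n) (w : 'rV[T]_n)
    (z : T[i]) :
  (forall i j, 0 <= M i j) -> (forall j, 0 < w 0 j) ->
  complex_eigenvalue M z ->
  exists j, ComplexField.Normc.normc z * w 0 j <= (w *m M) 0 j.
Proof.
have normcE (y : T[i]) : `|y| = real_complex T (ComplexField.Normc.normc y).
  by case: y.
have norm_real (x : T) : 0 <= x -> `|real_complex T x| = real_complex T x.
  by move=> x0; rewrite ger0_norm // ler0c.
move=> M0 w0 /eigenvalueP[v vM /rV0Pn[j0 vj0]].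
pose a j := ComplexField.Normc.normc (v 0 j) / w 0 j.
pose j := [arg max_(i > j0) a i]%O; exists j.
have amax i : a i <= a j by rewrite /j; case: arg_maxP => // k _; apply.
have normvE i : ComplexField.Normc.normc (v 0 i) = a i * w 0 i.
  by rewrite divfK ?gt_eqF.
have aj : 0 < a j.
  apply: lt_le_trans (amax j0); rewrite divr_gt0 //.
  by rewrite -ltcR -normcE normr_gt0.
rewrite -(ler_pM2l aj) mulrCA -normvE -ComplexField.Normc.normcM.
have -> : z * v 0 j = (z *: v) 0 j by rewrite mxE.
rewrite -vM !mxE mulr_sumr -lecR -normcE rmorph_sum /=.
apply: le_trans (ler_norm_sum _ _ _) _; apply: ler_sum => i _.
rewrite mxE normrM norm_real // normcE -rmorphM lecR normvE mulrA.
by rewrite ler_wpM2r // ler_wpM2r // ltW.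
Qed.

(** A solvent of a matrix polynomial gives a linear factor of it. *)
Lemma quadratic_factor (K : comNzRingType) (n : nat) (R A B C : 'M[K]_n)
    (x : K) :
  R *m R *m A + R *m B + C = 0 ->
  C + x *: B + x ^+ 2 *: A = (x%:M - R) *m ((x%:M + R) *m A + B).
Proof.
move=> RABC; rewrite -[LHS]subr0 -RABC mulmxDr mulmxA.
have -> : (x%:M - R) *m (x%:M + R) = (x ^+ 2)%:M - R *m R.
  rewrite mulmxBl !mulmxDr -scalar_mxM -expr2 -scalar_mxC.
  by rewrite opprD addrA addrK.
rewrite !mulmxBl !mul_scalar_mx [RHS]addrACA -opprD [_ + C]addrC.
rewrite [in LHS]opprD [LHS]addrA -[C + _ + _]addrA [C + _]addrC addrK.
by rewrite [X in X - _]addrC.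
Qed.

Lemma rate_matrix_sub1_unit (T : realType) (l : nat) (p q : T) (R : 'M[T]_l) :
  rate_matrix p q R -> 1%:M - R \in unitmx.
Proof.
case=> _ Rspec _; rewrite -opprB -scaleN1r unitmxZ ?unitrN1 //.
apply: contraT; rewrite -eigenvalue_unitmx -(eigenvalue_map (real_complex T)).
by move=> /Rspec; rewrite ComplexField.Normc.normc1 ltxx.
Qed.

(** The stochastic row sums of A_{-1} + A_0 + A_1 mean that L(1) kills the
    all-ones column; cancelling the invertible factor I - R leaves
    G(1) 1 = 0. *)
Lemma rate_matrix_stochastic (T : realType) (l : nat) (p q : T)
    (R : 'M[T]_l) :
  p + q = 1 -> rate_matrix p q R ->
  (qbd_block l p q (-1) + qbd_block l p q 0 + R *m qbd_block l p q (-1))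
    *m const_mx 1 = const_mx 1 :> 'cV[T]_l.
Proof.
move=> pq1 Rrate; have [_ _ Req] := Rrate.
have := quadratic_factor 1 Req.
move=> /(congr1 (fun M => M *m (const_mx 1 : 'cV[T]_l))).
rewrite expr1n !scale1r addrA [X in X *m _]addrAC mulmxBl mul1mx.
rewrite qbd_stochastic // subrr -mulmxA.
move=> /esym/(congr1 (mulmx (invmx (1%:M - R)))).
rewrite mulKmx ?(rate_matrix_sub1_unit Rrate) // mulmx0 addrA mulmxBl mul1mx.
by move=> /eqP; rewrite subr_eq0 [(_ + R) *m _]mulmxDl mul1mx addrAC => /eqP.
Qed.

(** This is G(x) = M - I with M = x A_{-1} + A_0 + R A_{-1}.  The row sums of
    M fall short of those of the stochastic matrix at x = 1 by (1 - x) times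
    those of A_{-1}, whose diagonal entries are q^(2l) > 0. *)
Lemma right_factor_unit (T : realType) (l : nat) (p q x : T)
    (R : 'M[T]_l) :
  0 <= p -> 0 < q -> p + q = 1 -> rate_matrix p q R -> 0 <= x < 1 ->
  (x%:M + R) *m qbd_block l p q (-1) + (qbd_block l p q 0 - 1%:M) \in unitmx.
Proof.
move=> p0 q0 pq1 Rrate /andP[x0 x1]; have [R0 _ _] := Rrate.
set A := qbd_block l p q (-1); set B := qbd_block l p q 0.
have qbd0 k i j : 0 <= qbd_block l p q k i j by rewrite mxE jump_ge0 // ltW.
have A0 i : 0 < A i i.
  rewrite mxE (_ : _ - _ = l%:Z - (2 * l)%N%:Z); last by lia.
  by rewrite jump_sub // binn subnn expr0 !mul1r exprn_gt0.
pose M := x *: A + B + R *m A.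
have M0 i j : 0 <= M i j.
  rewrite mxE [X in _ <= X + _]mxE [X in _ <= X + _ + _]mxE.
  rewrite [X in _ <= _ + X]mxE.
  rewrite addr_ge0 ?addr_ge0 ?mulr_ge0 ?sumr_ge0 ?qbd0 // => k _.
  by rewrite mulr_ge0 ?qbd0.
have -> : (x%:M + R) *m A + (B - 1%:M) = M - 1%:M.
  by rewrite mulmxDl mul_scalar_mx !addrA; congr (_ - _); rewrite addrAC.
(* Row sums of M are column sums of M^T, to be compared with the weight 1. *)
rewrite -unitmx_tr linearB /= tr_scalar_mx; apply: contraT.
rewrite -eigenvalue_unitmx -(eigenvalue_map (real_complex T)).
move=> /(@collatz_wielandt _ _ _ (const_mx 1))[i j|j|i].
- by rewrite mxE.
- by rewrite mxE ltr01.
have -> : const_mx 1 *m M^T = (M *m (const_mx 1 : 'cV[T]_l))^T.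
  by rewrite trmx_mul trmx_const.
have -> : M = A + B + R *m A - (1 - x) *: A.
  by rewrite scalerBl scale1r opprB [RHS]addrC /M -!addrA addKr.
rewrite mulmxBl rate_matrix_stochastic // ComplexField.Normc.normc1 mul1r.
have A1 : 0 < (A *m (const_mx 1 : 'cV[T]_l)) i 0.
  rewrite mxE (bigD1 i) //= [const_mx _ _ _]mxE mulr1 ltr_wpDr //.
  by apply: sumr_ge0 => k _; rewrite [const_mx _ _ _]mxE mulr1 qbd0.
rewrite -scalemxAl [X in X <= _]mxE [X in _ <= X]mxE [X in _ <= X]mxE.
rewrite [X in _ <= X + _]mxE [X in _ <= _ + X]mxE [X in _ - X]mxE.
by rewrite lerDl oppr_ge0 pmulr_rle0 ?subr_gt0 // leNgt A1.
Qed.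

Lemma max_eigenvalue_pos_row (T : realType) (n : nat) (M : 'M[T]_n)
    (w : 'rV[T]_n) (c : T) :
  (0 < n)%N -> (forall i j, 0 <= M i j) -> (forall j, 0 < w 0 j) -> 0 <= c ->
  w *m M = c *: w -> max_eigenvalue M c.
Proof.
move=> n0 M0 w0 c0 wM.
have cM : eigenvalue M c.
  apply/eigenvalueP; exists w => //; apply/rV0Pn; exists (Ordinal n0).
  by rewrite gt_eqF.
split=> //; rewrite /spectral_radius; set E := [set _ | _]%classic.
have Ec : E c.
  exists (real_complex T c); first by rewrite /complex_eigenvalue eigenvalue_map.
  by rewrite /= expr0n addr0 sqrtr_sqr ger0_norm.
have ubE : ubound E c.
  move=> _ [z zM <-]; have [j] := collatz_wielandt M0 w0 zM.
  by rewrite wM mxE ler_pM2r.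
apply/le_anti/andP; split; last by apply: ge_sup => //; exists c.
by apply: ub_le_sup => //; exists c.
Qed.

Theorem corollary3p7 (T : realType) (l : nat) (p q : T) (R : 'M[T]_l)
    (hl : (1 <= l)%N) (hp : 0 < p) (hq : q = 1 - p) (hpq : p < q)
    (hR : rate_matrix p q R) :
  let rho := p / q in
  let eta := rho ^+ (2 * l) in
  let u : 'cV[T]_l := \col_(i < l) rho ^+ (2 * i) in
  max_eigenvalue R eta /\ (u != 0 /\ u^T *m R = eta *: u^T).
Proof.
move=> rho eta u; have q0 : 0 < q by apply: lt_trans hpq.
have pq1 : p + q = 1 by rewrite hq addrC subrK.
have rho0 : 0 < rho by rewrite divr_gt0.
have rho1 : rho < 1 by rewrite ltr_pdivrMr // mul1r.
have eta01 : 0 <= eta < 1.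
  by rewrite exprn_ge0 ?ltW //= exprn_ilt1 ?ltW // muln_eq0 -lt0n.
have uE : u^T = \row_(i < l) (rho ^+ 2) ^+ i.
  by apply/rowP => i; rewrite !mxE exprM.
have u0 i : 0 < u^T 0 i by rewrite !mxE exprn_gt0.
(* rho^2 solves (p + q x)^(2l) = x^l. *)
have drift : p + q * rho ^+ 2 = rho.
  have pE : q * rho = p by rewrite mulrC divfK ?gt_eqF.
  by rewrite expr2 mulrA pE -[p in LHS]pE -mulrDl pE addrC pq1 mul1r.
have [R0 _ Req] := hR.
have uR : u^T *m R = eta *: u^T.
  have uL : u^T *m (qbd_block l p q 1 + eta *: (qbd_block l p q 0 - 1%:M)
      + eta ^+ 2 *: qbd_block l p q (-1)) = 0.
    have etaE : (rho ^+ 2) ^+ l = eta by rewrite -exprM.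
    have := qbd_row_genfun l p q (rho ^+ 2).
    rewrite drift -uE exprD etaE -expr2 => uP.
    rewrite scalerBr addrA [_ - _ + _]addrAC mulmxBr uP.
    by rewrite -scalemxAr mulmx1 subrr.
  move: uL; rewrite (quadratic_factor _ Req) mulmxA.
  move=> /(canRL (mulmxK (right_factor_unit (ltW hp) q0 pq1 hR eta01))).
  by rewrite mul0mx mulmxBr mul_mx_scalar => /eqP; rewrite subr_eq0 => /eqP.
split; last split=> //.
  by apply: max_eigenvalue_pos_row u0 _ uR => //; case/andP: eta01.
apply/eqP => /(congr1 (fun v : 'cV_l => v^T 0 (Ordinal hl))).
by move/eqP; rewrite gt_eqF // trmx0 [X in X < _]mxE.
Qed.
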